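(* Let $A=(a_{j,k})_{j\in\mathbb{Z},k\in\mathbb{N}}$ be a Köthe matrix on $\mathbb{Z}$, let $1\le p<\infty$ or $p=0$, and let $w=(w_j)_{j\in\mathbb{Z}}$ be a sequence of nonzero scalars satisfying $$\forall k\in\mathbb{N},\ \exists m\in\mathbb{N},\ m>k:\ \sup_{j\in\mathbb{Z}}|w_j|\frac{a_{j+1,k}}{a_{j,m}}<\infty$$ and $$\forall k\in\mathbb{N},\ \exists m\in\mathbb{N},\ m>k:\ \sup_{j\in\mathbb{Z}}\frac{a_{j,k}}{|w_j|\,a_{j+1,m}}<\infty,$$ where in the first condition $a_{j,m}=0$ is required to imply $a_{j+1,k}=0$, in the second condition $a_{j+1,m}=0$ is required to imply $a_{j,k}=0$, and in these cases $0/0$ is read as $1$. Then the following assertions are equivalent: (i) $F_w:\lambda_p(A,\mathbb{Z})\to\lambda_p(A,\mathbb{Z})$ is topologically expansive; (ii) there exists $k\in\mathbb{N}$ such that (a) $\sup_{n\in\mathbb{N}}|w_1\cdots w_n|\,a_{n+1,k}=\infty$, or (b) $\sup_{n\in\mathbb{N}}|w_{-n+1}\cdots w_0|^{-1}\,a_{-n+1,k}=\infty$.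
   Context: $\mathbb{K}$ is $\mathbb{R}$ or $\mathbb{C}$; $\mathbb{N}=\{1,2,\dots\}$. $A=(a_{j,k})_{j\in\mathbb{Z},k\in\mathbb{N}}$ is a Köthe matrix on $\mathbb{Z}$ if $0\le a_{j,k}\le a_{j,k+1}$ for all $j\in\mathbb{Z}$, $k\in\mathbb{N}$, and for each $j\in\mathbb{Z}$ there exists $k\in\mathbb{N}$ with $a_{j,k}>0$. For $1\le p<\infty$, $\lambda_p(A,\mathbb{Z})$ is the space of all $x=(x_j)_{j\in\mathbb{Z}}\in\mathbb{K}^{\mathbb{Z}}$ with $\|x\|_k:=\big(\sum_{j\in\mathbb{Z}}|x_ja_{j,k}|^p\big)^{1/p}<\infty$ for all $k\in\mathbb{N}$; $\lambda_0(A,\mathbb{Z})$ is the space of all $x\in\mathbb{K}^{\mathbb{Z}}$ with $\lim_{|j|\to\infty}x_ja_{j,k}=0$ for all $k\in\mathbb{N}$, with $\|x\|_k:=\sup_{j\in\mathbb{Z}}|x_j|a_{j,k}$. These are Fréchet spaces with topology given by the seminorms $(\|\cdot\|_k)_{k\in\mathbb{N}}$. The bilateral weighted forward shift is $F_w((x_n)_{n\in\mathbb{Z}}):=(w_{n-1}x_{n-1})_{n\in\mathbb{Z}}$; the two displayed conditions on $w$ are those ensuring that $F_w$ defines a continuous linear operator on $\lambda_p(A,\mathbb{Z})$ and that it is invertible with continuous inverse. An invertible operator $T$ is topologically expansive if for each nonzero $x$ there exists $k\in\mathbb{N}$ with $\sup_{n\in\mathbb{Z}}\|T^nx\|_k=\infty$.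 *)

(* Defs.v *)
From HB Require Import structures.
From mathcomp Require Import all_boot all_order all_algebra.
From mathcomp Require Import complex lra zify.
From mathcomp Require Import all_classical all_reals all_analysis.

Set Implicit Arguments.
Unset Strict Implicit.
Unset Printing Implicit Defensive.

Import Order.TTheory GRing.Theory Num.Theory.
Import numFieldNormedType.Exports.

Local Open Scope classical_set_scope.
Local Open Scope ring_scope.

Variant scalar_kind := RealScalars | ComplexScalars.

Definition scalar_field (R : realType) (s : scalar_kind) : numFieldType :=
  match s with RealScalars => R | ComplexScalars => R[i] end.

(* The norm of a numFieldType takes values in the field itself; seminorms need
   the modulus as an element of R. *)
Definition modulus (R : realType) (s : scalar_kind) : scalar_field R s -> R :=
  match s with
  | RealScalars => fun x : R => `|x|
  | ComplexScalars => fun z : R[i] => Normc.normc z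
  end.

Section modulus_lemmas.
Context {R : realType} {s : scalar_kind}.
Implicit Types x y : scalar_field R s.

Lemma modulus_ge0 x : 0 <= modulus x.
Proof.
by case: s x => x /=; [exact: normr_ge0|case: x => a b; exact: sqrtr_ge0].
Qed.

Lemma modulusM x y : modulus (x * y) = modulus x * modulus y.
Proof. by case: s x y => x y /=; [exact: normrM|exact: Normc.normcM]. Qed.

Lemma modulusV x : modulus x^-1 = (modulus x)^-1.
Proof. by case: s x => x /=; [exact: normfV|exact: Normc.normcV]. Qed.

Lemma modulusD x y : modulus (x + y) <= modulus x + modulus y.
Proof. by case: s x y => x y /=; [exact: ler_normD|exact: le_normcD]. Qed.

Lemma modulusN x : modulus (- x) = modulus x.
Proof. by case: s x => x /=; [exact: normrN|exact: normcN]. Qed.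

Lemma modulus_eq0 x : (modulus x == 0) = (x == 0).
Proof.
case: s x => x /=; first exact: normr_eq0.
by apply/eqP/eqP => [/Normc.eq0_normc//|->]; exact: Normc.normc0.
Qed.

Lemma modulus0 : modulus (0 : scalar_field R s) = 0.
Proof. by apply/eqP; rewrite modulus_eq0. Qed.

End modulus_lemmas.

(* The seminorm index k ranges over nat: column k of the matrix is a_{j,k+1}
   when columns are numbered from 1. *)
Record kothe_matrix (R : realType) := KotheMatrix {
  kothe_entry :> int -> nat -> R ;
  kothe_entry_ge0 : forall j k, 0 <= kothe_entry j k ;
  kothe_entry_le : forall j k, kothe_entry j k <= kothe_entry j k.+1 ;
  kothe_entry_gt0 : forall j, exists k, 0 < kothe_entry j k }.

Lemma kothe_entry_homo (R : realType) (A : kothe_matrix R) j k m :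
  (k <= m)%N -> A j k <= A j m.
Proof.
move/subnK => <-; elim: (m - k)%N => [|n IH]; rewrite ?add0n// addSn.
exact: le_trans IH (kothe_entry_le _ _ _).
Qed.

Variant kothe_exponent (R : realType) := ExpZero | ExpGe1 (p : R) of 1 <= p.

(* The filter of |j| -> oo on the integers. *)
Definition int_infty : set_system int :=
  filter_from setT (fun N : nat => [set j : int | (N <= `|j|)%N]).

Instance int_infty_filter : Filter int_infty.
Proof.
apply: filter_from_filter; first by exists 0%N.
move=> M N _ _; exists (maxn M N) => // j /=.
by rewrite geq_max => /andP[].
Qed.

Definition kothe_norm (R : realType) (s : scalar_kind) (A : kothe_matrix R)
    (p : kothe_exponent R) (k : nat) (x : int -> scalar_field R s) : \bar R :=
  match p with
  | ExpZero => ereal_sup (range (fun j => (modulus (x j) * A j k)%:E))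
  | ExpGe1 q _ =>
    (\esum_(j in [set: int]) ((modulus (x j) * A j k) `^ q)%:E) `^ q^-1
  end%E.

Definition kothe_set (R : realType) (s : scalar_kind) (A : kothe_matrix R)
    (p : kothe_exponent R) : set (int -> scalar_field R s) :=
  match p with
  | ExpZero =>
    [set x | forall k, modulus (x j) * A j k @[j --> int_infty] --> (0 : R)]
  | ExpGe1 _ _ => [set x | forall k, (kothe_norm A p k x < +oo)%E]
  end.

Section kothe_norm_lemmas.
Context {R : realType} {s : scalar_kind} {A : kothe_matrix R}
  {p : kothe_exponent R}.
Implicit Types x y : int -> scalar_field R s.

Lemma kothe_term_ge0 x j k : 0 <= modulus (x j) * A j k.
Proof. by rewrite mulr_ge0 ?modulus_ge0 ?kothe_entry_ge0. Qed.

Lemma kothe_norm_ge0 k x : (0 <= kothe_norm A p k x)%E.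
Proof.
rewrite /kothe_norm; case: p => [|q q1]; last exact: poweR_ge0.
apply: le_ereal_sup_tmp; exists (modulus (x 0) * A 0 k)%:E; first by exists 0.
by rewrite lee_fin kothe_term_ge0.
Qed.

(* A termwise bound between sequences, up to a shift d of the index, bounds
   the seminorms. *)
Lemma kothe_norm_dom (C : R) (d : int) k m x y : 0 <= C ->
  (forall j, modulus (x j) * A j k <=
     C * (modulus (y (j + d)) * A (j + d) m)) ->
  (kothe_norm A p k x <= C%:E * kothe_norm A p m y)%E.
Proof.
move=> C0 xy; rewrite /kothe_norm; case: p => [|q q1].
  apply: ge_ereal_sup => _ [j _ <-].
  apply: (@le_trans _ _ (C * (modulus (y (j + d)) * A (j + d) m))%:E).
    by rewrite lee_fin.
  rewrite EFinM lee_pmul ?lee_fin ?kothe_term_ge0//.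
  by apply: ereal_sup_ubound; exists (j + d).
have q0 : 0 < q by exact: lt_le_trans q1.
have -> : C%:E = ((C `^ q)%:E `^ q^-1)%E.
  by rewrite poweR_EFin -powRrM mulfV ?gt_eqF// powRr1.
rewrite -poweRM ?lee_fin ?powR_ge0//; last first.
  by apply: esum_ge0 => j _; rewrite lee_fin powR_ge0.
apply: gt0_ler_poweR; rewrite ?invr_ge0 ?(ltW q0)//.
- by rewrite in_itv/= leey andbT esum_ge0// => j _; rewrite lee_fin powR_ge0.
- rewrite in_itv/= leey andbT mule_ge0 ?lee_fin ?powR_ge0 ?esum_ge0// => j _.
  by rewrite lee_fin powR_ge0.
rewrite (reindex_esum [set: int] [set: int] (fun j => j + d)
  (fun j => ((modulus (y j) * A j m) `^ q)%:E)); last first.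
  split => // [i j _ _ /addIr//|j _].
  by exists (j - d) => //; rewrite subrK.
apply: (@le_trans _ _ (\esum_(j in [set: int]) ((C `^ q)%:E *
   ((modulus (y (j + d)) * A (j + d) m) `^ q)%:E)))%E.
  apply: le_esum => j _; rewrite -EFinM lee_fin -powRM ?kothe_term_ge0//.
  apply: ge0_ler_powR; rewrite ?nnegrE ?mulr_ge0 ?kothe_term_ge0 ?(ltW q0)//.
  - exact: modulus_ge0.
  - exact: kothe_entry_ge0.
  - exact: modulus_ge0.
  - exact: kothe_entry_ge0.
apply: ge_ereal_sup => _ [F [Ffin _] <-].
rewrite -ge0_mule_fsumr; last by move=> j; rewrite lee_fin powR_ge0.
apply: lee_wpmul2l; first by rewrite lee_fin powR_ge0.
by apply: ereal_sup_ubound; exists F.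
Qed.

Lemma kothe_norm_homo k m x : (k <= m)%N ->
  (kothe_norm A p k x <= kothe_norm A p m x)%E.
Proof.
move=> km; rewrite -[leRHS]mul1e; apply: (@kothe_norm_dom 1 0) => // j.
by rewrite mul1r addr0 ler_wpM2l ?modulus_ge0 ?kothe_entry_homo.
Qed.

Lemma kothe_norm0 k : kothe_norm A p k (fun=> 0 : scalar_field R s) = 0%E.
Proof.
apply/eqP; rewrite eq_le kothe_norm_ge0 andbT.
rewrite -(mul0e (kothe_norm A p k (fun=> 0 : scalar_field R s))).
by apply: (@kothe_norm_dom 0 0) => // j; rewrite modulus0 !mul0r.
Qed.

Lemma kothe_normN k x : kothe_norm A p k (fun j => - x j) = kothe_norm A p k x.
Proof.
apply/eqP; rewrite eq_le; apply/andP; split; rewrite -[leRHS]mul1e;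
  by apply: (@kothe_norm_dom 1 0) => // j; rewrite addr0 mul1r modulusN.
Qed.

Lemma kothe_normD_le (e : R) k x y : 0 <= e ->
  (kothe_norm A p k x <= e%:E -> kothe_norm A p k y <= e%:E ->
   kothe_norm A p k (fun j => x j + y j)%R <= (4 * e)%:E)%E.
Proof.
move=> e0; rewrite /kothe_norm; case: p => [|q q1].
  move=> xe ye; apply: ge_ereal_sup => _ [j _ <-].
  have xj : modulus (x j) * A j k <= e.
    by rewrite -lee_fin; apply: le_trans xe; apply: ereal_sup_ubound; exists j.
  have yj : modulus (y j) * A j k <= e.
    by rewrite -lee_fin; apply: le_trans ye; apply: ereal_sup_ubound; exists j.
  have := ler_wpM2r (kothe_entry_ge0 A j k) (modulusD (x j) (y j)).
  by rewrite lee_fin; nra.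
have q0 : 0 < q by exact: lt_le_trans q1.
have sum_ge0 (z : int -> scalar_field R s) :
    (0 <= \esum_(j in [set: int]) ((modulus (z j) * A j k) `^ q)%:E)%E.
  by apply: esum_ge0 => j _; rewrite lee_fin powR_ge0.
have normE (z : int -> scalar_field R s) c : 0 <= c ->
    ((\esum_(j in [set: int]) ((modulus (z j) * A j k) `^ q)%:E) `^ q^-1
       <= c%:E)%E =
    (\esum_(j in [set: int]) ((modulus (z j) * A j k) `^ q)%:E
       <= (c `^ q)%:E)%E.
  move=> c0; apply/idP/idP => h.
    have -> : (\esum_(j in [set: int]) ((modulus (z j) * A j k) `^ q)%:E =
       ((\esum_(j in [set: int]) ((modulus (z j) * A j k) `^ q)%:E)
          `^ q^-1) `^ q)%E.
      by rewrite -poweRrM mulVf ?gt_eqF// poweRe1.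
    rewrite -poweR_EFin; apply: gt0_ler_poweR; rewrite ?(ltW q0)//.
    - by rewrite in_itv/= leey andbT poweR_ge0.
    - by rewrite in_itv/= leey andbT lee_fin.
  have -> : c%:E = ((c `^ q)%:E `^ q^-1)%E.
    by rewrite poweR_EFin -powRrM mulfV ?gt_eqF// powRr1.
  apply: gt0_ler_poweR; rewrite ?invr_ge0 ?(ltW q0)//.
  - by rewrite in_itv/= leey andbT.
  - by rewrite in_itv/= leey andbT lee_fin powR_ge0.
rewrite !normE ?mulr_ge0// => xe ye.
apply: (@le_trans _ _ (\esum_(j in [set: int])
   (((2 * (modulus (x j) * A j k)) `^ q)%:E +
    ((2 * (modulus (y j) * A j k)) `^ q)%:E))%E).
  apply: le_esum => j _; rewrite -EFinD lee_fin.
  have := ler_wpM2r (kothe_entry_ge0 A j k) (modulusD (x j) (y j)).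
  rewrite mulrDl; have := kothe_term_ge0 x j k; have := kothe_term_ge0 y j k.
  have := kothe_term_ge0 (fun j => x j + y j) j k => /=.
  move: (modulus (x j + y j) * _) (modulus (x j) * _) (modulus (y j) * _).
  move=> u a b u0 b0 a0 uab.
  have [ab|ba] := leP a b.
  - apply: (@le_trans _ _ ((2 * b) `^ q)); last by rewrite lerDr powR_ge0.
    by apply: ge0_ler_powR; rewrite ?nnegrE ?(ltW q0)//; lra.
  - apply: (@le_trans _ _ ((2 * a) `^ q)); last by rewrite lerDl powR_ge0.
    by apply: ge0_ler_powR; rewrite ?nnegrE ?(ltW q0)//; lra.
rewrite esumD => [|j _|j _]; [|by rewrite lee_fin powR_ge0..].
have scal (z : int -> scalar_field R s) :
    (\esum_(j in [set: int]) ((modulus (z j) * A j k) `^ q)%:E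
       <= (e `^ q)%:E)%E ->
    (\esum_(j in [set: int]) ((2 * (modulus (z j) * A j k)) `^ q)%:E
       <= ((2 * e) `^ q)%:E)%E.
  move=> ze; apply: ge_ereal_sup => _ [F [Ffin _] <-].
  under eq_fsbigr do rewrite powRM ?kothe_term_ge0// EFinM.
  rewrite -ge0_mule_fsumr; last by move=> j; rewrite lee_fin powR_ge0.
  rewrite powRM// EFinM; apply: lee_wpmul2l; first by rewrite lee_fin powR_ge0.
  by apply: le_trans ze; apply: ereal_sup_ubound; exists F.
apply: le_trans (leeD (scal _ xe) (scal _ ye)) _.
rewrite -EFinD lee_fin.
have -> : 4 * e = 2 * (2 * e) by lra.
rewrite [leRHS]powRM ?mulr_ge0//.
have := powR_ge0 (2 * e) q.
have : 2 <= 2 `^ q :> R by rewrite -[leLHS]powRr1//; apply: ler_powR => //; lra.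
by nra.
Qed.

Lemma kothe_set_dom (d : int) x y : kothe_set A p y ->
  (forall k, exists m (C : R), 0 <= C /\ forall j,
     modulus (x j) * A j k <= C * (modulus (y (j + d)) * A (j + d) m)) ->
  kothe_set A p x.
Proof.
move=> yA xy.
case: p yA (@kothe_norm_dom) => [|q q1] /= yA dom k;
    have [m [C [C0 xyj]]] := xy k; last first.
  apply: le_lt_trans (dom _ _ _ _ _ _ C0 xyj) _.
  by rewrite lte_mul_pinfty ?lee_fin//; exact: kothe_norm_ge0.
have shift : (j + d : int) @[j --> int_infty] --> int_infty.
  move=> B [N _ NB]; exists (N + `|d|)%N => // j /= jN.
  by apply: NB => /=; lia.
have lim : C * (modulus (y (j + d)) * A (j + d) m) @[j --> int_infty] --> (0:R).
  rewrite -[X in _ --> X](mulr0 C).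
  apply: cvgM; first exact: cvg_cst.
  exact: (cvg_comp _ (fun j => modulus (y j) * A j m) shift (yA m)).
apply: (squeeze_cvgr _ (cvg_cst 0) lim).
by apply: nearW => j; rewrite xyj kothe_term_ge0.
Qed.

Lemma kothe_set0 : kothe_set A p (fun=> 0 : scalar_field R s).
Proof.
case: p (@kothe_norm0) => [|q q1] norm0 k; last by rewrite norm0.
under eq_fun do rewrite modulus0 mul0r; exact: cvg_cst.
Qed.

Lemma kothe_setD x y : kothe_set A p x -> kothe_set A p y ->
  kothe_set A p (fun j => x j + y j).
Proof.
case: p (@kothe_normD_le) (@kothe_norm_ge0) => [|q q1] normD norm_ge0 xA yA k.
  have lim : modulus (x j) * A j k + modulus (y j) * A j k
      @[j --> int_infty] --> (0 : R).
    by rewrite -[X in _ --> X]addr0; exact: cvgD (xA k) (yA k).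
  apply: (squeeze_cvgr _ (cvg_cst 0) lim).
  apply: nearW => j; rewrite -mulrDl (kothe_term_ge0 (fun j => x j + y j))/=.
  by rewrite ler_wpM2r ?kothe_entry_ge0 ?modulusD.
pose a := kothe_norm A (ExpGe1 q1) k x; pose b := kothe_norm A (ExpGe1 q1) k y.
have fina : a \is a fin_num by rewrite ge0_fin_numE ?norm_ge0//; exact: xA.
have finb : b \is a fin_num by rewrite ge0_fin_numE ?norm_ge0//; exact: yA.
have fa0 : 0 <= fine a by rewrite fine_ge0 ?norm_ge0.
have fb0 : 0 <= fine b by rewrite fine_ge0 ?norm_ge0.
apply: le_lt_trans (normD (fine a + fine b) k x y _ _ _) _.
- by rewrite addr_ge0.
- by rewrite -[leLHS](fineK fina) lee_fin lerDl.
- by rewrite -[leLHS](fineK finb) lee_fin lerDr.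
- exact: ltry.
Qed.

Lemma kothe_setZ (c : scalar_field R s) x : kothe_set A p x ->
  kothe_set A p (fun j => c * x j).
Proof.
move=> xA; apply: (@kothe_set_dom 0 _ x) => // k.
exists k, (modulus c); split=> [|j]; first exact: modulus_ge0.
by rewrite addr0 modulusM mulrA.
Qed.

End kothe_norm_lemmas.

Definition kothe_pred (R : realType) (s : scalar_kind) (A : kothe_matrix R)
  (p : kothe_exponent R) : {pred int -> scalar_field R s} :=
  mem (kothe_set A p).

Arguments kothe_pred {R} s A p.

Record kothe_space (R : realType) (s : scalar_kind) (A : kothe_matrix R)
    (p : kothe_exponent R) := KotheSpace {
  kothe_seq :> int -> scalar_field R s ;
  kothe_seqP : kothe_seq \in kothe_pred s A p }.

Arguments kothe_space {R} s A p.

Section kothe_space_lmod.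
Context (R : realType) (s : scalar_kind) (A : kothe_matrix R)
  (p : kothe_exponent R).

HB.instance Definition _ :=
  [isSub of kothe_space s A p for @kothe_seq R s A p].
HB.instance Definition _ := [Choice of kothe_space s A p by <:].

Lemma kothe_pred_submod_closed : submod_closed (kothe_pred s A p).
Proof.
split; first by rewrite inE; exact: kothe_set0.
move=> c x y; rewrite !inE => xA yA.
exact: kothe_setD (kothe_setZ c xA) yA.
Qed.

HB.instance Definition _ :=
  GRing.isSubmodClosed.Build _ _ (kothe_pred s A p) kothe_pred_submod_closed.
HB.instance Definition _ :=
  [SubChoice_isSubLmodule of kothe_space s A p by <:].

End kothe_space_lmod.

Section kothe_space_topology.
Context (R : realType) (s : scalar_kind) (A : kothe_matrix R)
  (p : kothe_exponent R).
Notation X := (kothe_space s A p).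
Implicit Types x y z : X.

Definition kothe_seminorm (k : nat) (x : X) : \bar R := kothe_norm A p k x.

Lemma kothe_seminorm0 k : kothe_seminorm k 0 = 0%E.
Proof. exact: kothe_norm0. Qed.

Lemma kothe_seminormB k x y :
  kothe_seminorm k (x - y) = kothe_seminorm k (y - x).
Proof. by rewrite -opprB; exact: kothe_normN. Qed.

Lemma kothe_seminormD_le (e : R) k x y : 0 <= e ->
  (kothe_seminorm k x <= e%:E -> kothe_seminorm k y <= e%:E ->
   kothe_seminorm k (x + y)%R <= (4 * e)%:E)%E.
Proof. exact: kothe_normD_le. Qed.

(* The seminorms increase with k, so the balls of single seminorms form a
   neighbourhood base. *)
Definition kothe_nbhs (x : X) : set_system X :=
  filter_from [set ke : nat * R | 0 < ke.2]
    (fun ke => [set y | (kothe_seminorm ke.1 (y - x)%R < ke.2%:E)%E]).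

HB.instance Definition _ := hasNbhs.Build (kothe_space s A p) kothe_nbhs.

Lemma kothe_nbhs_filter x : ProperFilter (kothe_nbhs x).
Proof.
apply: filter_from_proper; last first.
  by move=> [k e] /= e0; exists x; rewrite /= subrr kothe_seminorm0 lte_fin.
apply: filter_from_filter; first by exists (0%N, 1) => /=.
move=> [k e] [m d] /= e0 d0; exists (maxn k m, Num.min e d) => /=.
  by rewrite lt_min e0.
move=> y /=; rewrite EFin_min lt_min => /andP[ye yd]; split.
- by apply: le_lt_trans ye; apply: kothe_norm_homo; exact: leq_maxl.
- by apply: le_lt_trans yd; apply: kothe_norm_homo; exact: leq_maxr.
Qed.

Lemma kothe_nbhs_singleton x (B : set X) : kothe_nbhs x B -> B x.
Proof.
by move=> [[k e] /= e0]; apply; rewrite /= subrr kothe_seminorm0 lte_fin.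
Qed.

Lemma kothe_nbhs_nbhs x (B : set X) :
  kothe_nbhs x B -> kothe_nbhs x (kothe_nbhs^~ B).
Proof.
move=> [[k e] /= e0 eB]; have e8 : 0 < e / 8 by rewrite divr_gt0.
exists (k, e / 8) => //= y /= yx; exists (k, e / 8) => //= z /= zy; apply: eB.
rewrite /= -(subrK y z) -addrA.
apply: le_lt_trans (kothe_seminormD_le (ltW e8) (ltW zy) (ltW yx)) _.
by rewrite lte_fin; lra.
Qed.

HB.instance Definition _ := Nbhs_isNbhsTopological.Build (kothe_space s A p)
  kothe_nbhs_filter kothe_nbhs_singleton kothe_nbhs_nbhs.

End kothe_space_topology.

(* Integer iterates of T, with S in the role of the inverse of T. *)
Definition int_iter (X : Type) (T S : X -> X) (n : int) (x : X) : X :=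
  match n with Posz m => iter m T x | Negz m => iter m.+1 S x end.

Definition continuous_linear (K : numDomainType) (X : preTopologicalLmodType K)
    (T : X -> X) : Prop :=
  linear T /\ continuous T.

(* q is the family of seminorms defining the topology of X. *)
Definition topologically_expansive (R : realType) (K : numDomainType)
    (X : preTopologicalLmodType K) (q : nat -> X -> \bar R)
    (T : X -> X) : Prop :=
  continuous_linear T /\
  exists S : X -> X, [/\ continuous_linear S, cancel T S, cancel S T &
    forall x : X, x != 0 -> exists k : nat,
      ereal_sup (range (fun n : int => q k (int_iter T S n x))) = +oo%E].

(* The quotient x / y with the convention 0 / 0 = 1. *)
Definition quot01 (R : realType) (x y : R) : R :=
  if (x == 0) && (y == 0) then 1 else x / y.

Definition shift_bounded (R : realType) (s : scalar_kind) (A : kothe_matrix R)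
    (w : int -> scalar_field R s) : Prop :=
  forall k : nat, exists m : nat, [/\ (k < m)%N,
    forall j : int, A j m = 0 -> A (j + 1) k = 0 &
    (ereal_sup (range (fun j : int =>
       (modulus (w j) * quot01 (A (j + 1) k) (A j m))%:E)) < +oo)%E].

Definition inverse_shift_bounded (R : realType) (s : scalar_kind)
    (A : kothe_matrix R) (w : int -> scalar_field R s) : Prop :=
  forall k : nat, exists m : nat, [/\ (k < m)%N,
    forall j : int, A (j + 1) m = 0 -> A j k = 0 &
    (ereal_sup (range (fun j : int =>
       (quot01 (A j k) (modulus (w j) * A (j + 1) m))%:E)) < +oo)%E].

Definition shift_seq (R : realType) (s : scalar_kind)
    (w x : int -> scalar_field R s) (n : int) : scalar_field R s :=
  w (n - 1) * x (n - 1).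

Section forward_shift.
Context (R : realType) (s : scalar_kind) (A : kothe_matrix R)
  (p : kothe_exponent R).
Context (w : int -> scalar_field R s).

Lemma shift_seq_bound k m (C : R) (x : int -> scalar_field R s) :
  (forall j : int, A j m = 0 -> A (j + 1) k = 0) ->
  (forall j, modulus (w j) * quot01 (A (j + 1) k) (A j m) <= C) ->
  forall j, modulus (shift_seq w x j) * A j k <=
    C * (modulus (x (j - 1)) * A (j - 1) m).
Proof.
move=> A0 wC j; rewrite /shift_seq modulusM.
have := A0 (j - 1); have := wC (j - 1); rewrite /quot01 subrK => {}wC {}A0.
rewrite [leRHS]mulrCA mulrAC [leLHS]mulrC ler_wpM2l ?modulus_ge0//.
have [Am0|Am0] := eqVneq (A (j - 1) m) 0.
  by rewrite Am0 (A0 Am0) !mulr0.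
have Am_gt0 : 0 < A (j - 1) m by rewrite lt_neqAle eq_sym Am0 kothe_entry_ge0.
by move: wC; rewrite (negbTE Am0) andbF mulrA ler_pdivrMr.
Qed.

Lemma shift_seq_kothe (x : int -> scalar_field R s) : shift_bounded A w ->
  kothe_set A p x -> kothe_set A p (shift_seq w x).
Proof.
move=> wA xA; apply: (@kothe_set_dom _ _ _ _ (- 1) _ x) => // k.
have [m [_ A0 wC]] := wA k.
set u := ereal_sup _ in wC; exists m, (fine u).
have u0 : (0 <= u)%E.
  apply: le_ereal_sup_tmp; exists (modulus (w 0) * quot01 (A (0 + 1) k) (A 0 m))%:E.
    by exists 0.
  rewrite lee_fin mulr_ge0 ?modulus_ge0// /quot01; case: ifP => // _.
  by rewrite divr_ge0 ?kothe_entry_ge0.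
split=> [|j]; first exact: fine_ge0.
apply: shift_seq_bound => // i.
rewrite -lee_fin fineK ?ge0_fin_numE//.
by apply: ereal_sup_ubound; exists i.
Qed.

Lemma forward_shift_subproof (wA : shift_bounded A w) (x : kothe_space s A p) :
  shift_seq w x \in kothe_pred s A p.
Proof.
by rewrite inE; apply: shift_seq_kothe => //; have := valP x; rewrite inE.
Qed.

Definition forward_shift (wA : shift_bounded A w) (x : kothe_space s A p) :
    kothe_space s A p :=
  KotheSpace (forward_shift_subproof wA x).

End forward_shift.

Arguments forward_shift {R s A} p {w} wA x.

(* Main.v *)
Require Import Defs.
From mathcomp Require Import all_boot all_order all_algebra.
From mathcomp Require Import ring zify.
From mathcomp Require Import all_classical all_reals all_analysis.

Import Order.TTheory GRing.Theory Num.Theory.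
Import numFieldNormedType.Exports.

Local Open Scope classical_set_scope.
Local Open Scope ring_scope.

(* F_w^n moves x_(j+1) to position j + n + 1 and multiplies its modulus by
   u_(j+n) / u_j, where u_n = |w_1 ... w_n| and u_(-n) = |w_(-n+1) ... w_0|^-1.
   So a single nonzero coordinate of x bounds ||F_w^n x||_k from below by a
   constant multiple of u_(j+n) a_(j+n+1,k), and for the unit vector e_1 this
   bound is an equality. Hence all nonzero orbits are unbounded exactly when
   that of e_1 is, and conditions (a) and (b) say that its forward or its
   backward half is unbounded. *)

(** * Suprema in the extended reals *)

Lemma ereal_sup_range_pinfty (R : realType) (I : Type) (f : I -> \bar R) :
  ereal_sup (range f) = +oo%E <-> forall M : R, exists i, (M%:E < f i)%E.
Proof.
split => [supf M|fM].
  have : (M%:E < ereal_sup (range f))%E by rewrite supf ltry.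
  by move=> /ereal_sup_gt[_ [i _ <-]] Mi; exists i.
apply/eqyP => M _; have [i /ltW Mi] := fM M.
by apply: le_trans Mi _; apply: ereal_sup_ubound; exists i.
Qed.

Lemma ereal_sup_setU (R : realType) (B C : set (\bar R)) :
  ereal_sup (B `|` C) = maxe (ereal_sup B) (ereal_sup C).
Proof.
apply/eqP; rewrite eq_le; apply/andP; split.
  apply: ge_ereal_sup => y [By|Cy]; rewrite le_max.
    by rewrite (ereal_sup_ubound By).
  by rewrite (ereal_sup_ubound Cy) orbT.
rewrite ge_max; apply/andP.
by split; apply: ereal_sup_le; [exact: subsetUl|exact: subsetUr].
Qed.

Lemma modulus1 (R : realType) (s : scalar_kind) :
  modulus (1 : scalar_field R s) = 1.
Proof.
have m0 : modulus (1 : scalar_field R s) != 0 by rewrite modulus_eq0 oner_eq0.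
by apply: (mulfI m0); rewrite -modulusM !mulr1.
Qed.

(** * Seminorms and single coordinates *)

Section kothe_norm_coordinates.
Context {R : realType} {s : scalar_kind} {A : kothe_matrix R}
  {p : kothe_exponent R}.
Implicit Types x : int -> scalar_field R s.

Lemma kothe_norm_supp1 k j x : (forall i, i != j -> x i = 0) ->
  kothe_norm A p k x = (modulus (x j) * A j k)%:E.
Proof.
move=> x0; rewrite /kothe_norm; case: p => [|q q1].
  apply/eqP; rewrite eq_le; apply/andP; split.
    apply: ge_ereal_sup => _ [i _ <-]; rewrite lee_fin.
    have [->//|ij] := eqVneq i j.
    by rewrite x0// modulus0 mul0r kothe_term_ge0.
  by apply: ereal_sup_ubound; exists j.
have q0 : q != 0 by rewrite gt_eqF// (lt_le_trans _ q1).
rewrite (_ : (fun i => _) = fun i =>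
    if i \in [set j] then ((modulus (x i) * A i k) `^ q)%:E else 0%E).
  rewrite -esum_mkcond esum_set1 ?lee_fin ?powR_ge0//.
  by rewrite poweR_EFin -powRrM mulfV// powRr1// kothe_term_ge0.
apply/funext => i; rewrite in_set1.
by case: eqVneq => // ij; rewrite x0// modulus0 mul0r powR0.
Qed.

(** Truncating [x] to its coordinate [j] shrinks every term, and the truncation [y] has a seminorm
    with a single term. *)
Lemma kothe_norm_coord k j x :
  ((modulus (x j) * A j k)%:E <= kothe_norm A p k x)%E.
Proof.
pose y i := if i == j then x j else 0.
have -> : modulus (x j) = modulus (y j) by rewrite /y eqxx.
rewrite -(@kothe_norm_supp1 k j y); last by move=> i /negbTE; rewrite /y => ->.
rewrite -[leRHS]mul1e; apply: (@kothe_norm_dom _ _ _ _ 1 0) => // i.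
rewrite addr0 mul1r ler_wpM2r ?kothe_entry_ge0// /y.
by case: eqVneq => [->|_] //; rewrite modulus0 modulus_ge0.
Qed.

Lemma kothe_set_supp1 j x : (forall i, i != j -> x i = 0) -> kothe_set A p x.
Proof.
move=> x0; case: p (@kothe_norm_supp1) => [|q q1] supp1 k; last first.
  by rewrite (supp1 _ _ _ x0) ltry.
(* For exponent zero, the terms are constantly 0 beyond this threshold, which is one more than the
   absolute value of [j] so as to exclude [j] itself. *)
apply: cvg_near_cst; exists `|j|.+1 => // i /= ji.
rewrite x0 ?modulus0 ?mul0r//.
by apply: contraL ji => /eqP ->; rewrite ltnn.
Qed.

End kothe_norm_coordinates.

(** * Continuity from seminorm estimates *)

Lemma kothe_continuous_linear (R : realType) (s : scalar_kind)
    (A : kothe_matrix R) (p : kothe_exponent R)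
    (T : kothe_space s A p -> kothe_space s A p) : linear T ->
  (forall k, exists m (C : R), 0 <= C /\ forall x,
    (kothe_seminorm k (T x) <= C%:E * kothe_seminorm m x)%E) ->
  continuous_linear T.
Proof.
move=> linT bT; split=> // x B [[k e] /= e0 eB].
have [m [C [C0 TC]]] := bT k.
(* Dividing by [C + 1] rather than [C] gives a valid radius even when [C = 0]. *)
have C1 : 0 < C + 1 by rewrite ltr_wpDl.
exists (m, e / (C + 1)) => [|y /= yx]; first exact: divr_gt0.
apply: eB => /=.
have -> : T y - T x = T (y - x).
  have := linT (-1) x y; rewrite !scaleN1r addrC (addrC _ y) => ->.
  by rewrite addrC.
apply: le_lt_trans (TC _) _.
have fin : kothe_seminorm m (y - x) \is a fin_num.
  by rewrite ge0_fin_numE ?kothe_norm_ge0//; apply: lt_trans yx (ltry _).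
move: yx; rewrite -(fineK fin) -EFinM !lte_fin ltr_pdivlMr// => yx.
apply: le_lt_trans yx; rewrite mulrC ler_wpM2l ?fine_ge0 ?kothe_norm_ge0//.
by rewrite lerDl.
Qed.

Lemma ereal_sup_range_lty (R : realType) (I : Type) (f : I -> R) :
  (ereal_sup (range (fun i => (f i)%:E)) < +oo)%E ->
  exists C : R, 0 <= C /\ forall i, f i <= C.
Proof.
(* The absolute value keeps the bound nonnegative even if the supremum is negative. *)
set u := ereal_sup _ => uy; exists `|fine u|; split=> // i.
have fu : ((f i)%:E <= u)%E by apply: ereal_sup_ubound; exists i.
have fin : u \is a fin_num.
  by rewrite fin_real// uy andbT (lt_le_trans _ fu)// ltNyr.
by apply: le_trans (ler_norm _); rewrite -lee_fin fineK.
Qed.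

(** * The shift, its inverse and the orbit formula *)

Section shifts.
Context {R : realType} {s : scalar_kind} {A : kothe_matrix R}
  {p : kothe_exponent R} {w : int -> scalar_field R s}.
Implicit Types x : int -> scalar_field R s.

Lemma shift_seq_dom : shift_bounded A w ->
  forall k, exists m (C : R), 0 <= C /\ forall x j,
    modulus (shift_seq w x j) * A j k <=
      C * (modulus (x (j - 1)) * A (j - 1) m).
Proof.
move=> wA k; have [m [_ A0 /ereal_sup_range_lty[C [C0 wC]]]] := wA k.
by exists m, C; split=> // x j; exact: shift_seq_bound.
Qed.

(** The inverse of F_w: the solution y of [w j * y j = x (j + 1)]. *)
Definition unshift_seq (w x : int -> scalar_field R s) (j : int) :
    scalar_field R s :=
  (w j)^-1 * x (j + 1).

Context (w_neq0 : forall j, w j != 0).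

Lemma modulus_weight_gt0 j : 0 < modulus (w j).
Proof. by rewrite lt_neqAle eq_sym modulus_eq0 w_neq0 modulus_ge0. Qed.

Lemma unshift_seq_dom : inverse_shift_bounded A w ->
  forall k, exists m (C : R), 0 <= C /\ forall x j,
    modulus (unshift_seq w x j) * A j k <=
      C * (modulus (x (j + 1)) * A (j + 1) m).
Proof.
move=> wA k; have [m [_ A0 /ereal_sup_range_lty[C [C0 wC]]]] := wA k.
exists m, C; split=> // x j; rewrite /unshift_seq modulusM modulusV.
rewrite mulrAC mulrC [leRHS]mulrCA ler_wpM2l ?modulus_ge0//.
(* If the denominator entry vanishes, so does [A j k], and both sides are 0; otherwise [quot01] is a
   genuine quotient. *)
have [Am0|Am0] := eqVneq (A (j + 1) m) 0; first by rewrite Am0 A0// !mulr0.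
have Am_gt0 : 0 < A (j + 1) m by rewrite lt_neqAle eq_sym Am0 kothe_entry_ge0.
have wj := modulus_weight_gt0 j.
move: (wC j); rewrite /quot01 mulf_eq0 (gt_eqF wj) (gt_eqF Am_gt0) andbF.
by rewrite ler_pdivrMr ?mulr_gt0// mulrCA ler_pdivrMl.
Qed.

Lemma unshift_subproof (wA : inverse_shift_bounded A w)
    (x : kothe_space s A p) : unshift_seq w x \in kothe_pred s A p.
Proof.
rewrite inE; apply: (@kothe_set_dom _ _ _ _ 1 _ x).
  by have := valP x; rewrite inE.
move=> k; have [m [C [C0 xC]]] := unshift_seq_dom wA k.
by exists m, C.
Qed.

Definition unshift (wA : inverse_shift_bounded A w) (x : kothe_space s A p) :
    kothe_space s A p :=
  KotheSpace (unshift_subproof wA x).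

Lemma forward_shift_continuous_linear (wA : shift_bounded A w) :
  continuous_linear (forward_shift p wA).
Proof.
apply: kothe_continuous_linear => [c x y|k].
  by apply: val_inj; apply/funext => j /=; rewrite /shift_seq mulrDr mulrCA.
have [m [C [C0 xC]]] := shift_seq_dom wA k.
by exists m, C; split=> // x; exact: kothe_norm_dom (xC x).
Qed.

Lemma unshift_continuous_linear (wA : inverse_shift_bounded A w) :
  continuous_linear (unshift wA).
Proof.
apply: kothe_continuous_linear => [c x y|k].
  by apply: val_inj; apply/funext => j /=; rewrite /unshift_seq mulrDr mulrCA.
have [m [C [C0 xC]]] := unshift_seq_dom wA k.
by exists m, C; split=> // x; exact: kothe_norm_dom (xC x).
Qed.

Lemma forward_shiftK (wA : shift_bounded A w) (wB : inverse_shift_bounded A w) :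
  cancel (forward_shift p wA) (unshift wB).
Proof.
move=> x; apply: val_inj; apply/funext => j /=.
by rewrite /unshift_seq /= /shift_seq addrK mulKf.
Qed.

Lemma unshiftK (wA : shift_bounded A w) (wB : inverse_shift_bounded A w) :
  cancel (unshift wB) (forward_shift p wA).
Proof.
move=> x; apply: val_inj; apply/funext => j /=.
by rewrite /shift_seq /= /unshift_seq subrK mulVKf.
Qed.

(* [weight_prod n] is the modulus of the coordinate n + 1 of F_w^n e_1. *)
Definition weight_prod (n : int) : R :=
  match n with
  | Posz m => modulus (\prod_(1 <= i < m.+1) w i%:Z)
  | Negz m => (modulus (\prod_(0 <= i < m.+1) w (- i%:Z)))^-1
  end.

Lemma weight_prod_gt0 n : 0 < weight_prod n.
Proof.
have prod_gt0 (r : seq nat) (f : nat -> int) :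
    0 < modulus (\prod_(i <- r) w (f i)).
  rewrite lt_neqAle eq_sym modulus_eq0 modulus_ge0 andbT prodf_seq_neq0.
  by apply/allP => i _ /=.
by case: n => n /=; rewrite ?invr_gt0 prod_gt0.
Qed.

(** This extends the [Negz] branch to n = 0, where both branches are empty products. *)
Lemma weight_prodN (n : nat) :
  weight_prod (- n%:Z) = (modulus (\prod_(0 <= i < n) w (- i%:Z)))^-1.
Proof.
case: n => [|n]; last by rewrite -NegzE.
by rewrite oppr0 /= !big_geq// -modulusV invr1.
Qed.

(** One recursion serves all of Z: a step to the right appends a factor to the product for n >= 0
    and cancels the last inverted factor for n < 0. *)
Lemma weight_prodS n :
  weight_prod (n + 1) = modulus (w (n + 1)) * weight_prod n.
Proof.
case: n => n.
  by rewrite -PoszD addn1 /= big_nat_recr//= modulusM mulrC.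
have -> : Negz n + 1 = - n%:Z by rewrite NegzE; lia.
rewrite weight_prodN /= big_nat_recr//= modulusM invfM mulrCA mulfV ?mulr1//.
by rewrite gt_eqF// modulus_weight_gt0.
Qed.

(** The orbit formula, cleared of denominators. Only [SK] is assumed of [S], so that it applies both
    to [unshift] and to the inverse supplied by expansiveness. *)
Lemma int_iter_forward_shift (wA : shift_bounded A w)
    (S : kothe_space s A p -> kothe_space s A p) :
  cancel S (forward_shift p wA) -> forall (x : kothe_space s A p) (n j : int),
  modulus (int_iter (forward_shift p wA) S n x (j + n + 1)) * weight_prod j =
  modulus (x (j + 1)) * weight_prod (j + n).
Proof.
move=> SK x n j.
have iterS (m : nat) : modulus (iter m S x (j - m%:Z + 1)) * weight_prod j =
    modulus (x (j + 1)) * weight_prod (j - m%:Z).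
  elim: m => [|m IH]; first by rewrite subr0.
  (* The value of [S] is known only through F_w: multiplied by [w (j - m)], its coordinate j - m
     becomes the coordinate j - m + 1 of the previous iterate. *)
  apply: (mulfI (lt0r_neq0 (modulus_weight_gt0 (j - m%:Z)))).
  have jE : j - m.+1%:Z + 1 = j - m%:Z by lia.
  have := weight_prodS (j - m.+1%:Z); rewrite jE => wS.
  rewrite mulrA mulrCA -wS -IH -modulusM; congr (modulus _ * _).
  have := congr1 (fun y : kothe_space s A p => y (j - m%:Z + 1))
    (SK (iter m S x)).
  by rewrite /= /shift_seq addrK => ->.
case: n => m; last by rewrite NegzE; exact: (iterS m.+1).
elim: m => [|m IH]; first by rewrite addr0.
have jE : j + m.+1%:Z = j + m%:Z + 1 by lia.
rewrite /= /shift_seq addrK jE modulusM weight_prodS -mulrA.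
by rewrite [in RHS]mulrCA -IH.
Qed.

End shifts.

(** * The orbit of e_1 and the equivalence *)

Lemma unit_seq_subproof (R : realType) (s : scalar_kind) (A : kothe_matrix R)
    (p : kothe_exponent R) (j : int) :
  (fun i => (i == j)%:R : scalar_field R s) \in kothe_pred s A p.
Proof. by rewrite inE; apply: (@kothe_set_supp1 _ _ _ _ j) => i /negbTE ->. Qed.

Definition unit_seq (R : realType) (s : scalar_kind) (A : kothe_matrix R)
    (p : kothe_exponent R) (j : int) : kothe_space s A p :=
  KotheSpace (unit_seq_subproof R s A p j).

Lemma weight_prod_sup (R : realType) (s : scalar_kind)
    (w : int -> scalar_field R s) (A : kothe_matrix R) (k : nat) :
  ereal_sup (range (fun n : int => (weight_prod (w := w) n * A (n + 1) k)%:E))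
    = +oo%E <->
  (ereal_sup [set (modulus (\prod_(1 <= i < n.+1) w i%:Z) *
                   A (n%:Z + 1) k)%:E | n in [set n : nat | (1 <= n)%N]]
     = +oo%E \/
   ereal_sup [set ((modulus (\prod_(0 <= i < n) w (- i%:Z)))^-1 *
                   A (- n%:Z + 1) k)%:E | n in [set n : nat | (1 <= n)%N]]
     = +oo%E).
Proof.
set f := fun n : int => _; set U := (X in ereal_sup X = _ \/ _).
set V := (X in _ \/ ereal_sup X = _).
have UE : U = [set f n%:Z | n in [set n : nat | (1 <= n)%N]] by [].
have VE : V = [set f (- n%:Z) | n in [set n : nat | (1 <= n)%N]].
  by apply: eq_imagel => n _; rewrite /f weight_prodN.
(* The integers split into 0, the positive and the negative ones; the term at 0 is finite, so an
   infinite supremum comes from one of the two halves. *)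
have -> : range f = [set f 0] `|` U `|` V.
  rewrite UE VE; apply/seteqP.
  split=> [_ [[[|n]|n] _ <-]|_ [[->|[n _ <-]]|[n _ <-]]].
  - by left; left.
  - by left; right; exists n.+1.
  - by right; exists n.+1.
  - by exists 0.
  - by exists n%:Z.
  - by exists (- n%:Z).
rewrite !ereal_sup_setU ereal_sup1.
split=> [|[] ->]; last 2 first.
- by rewrite maxey maxye.
- by rewrite maxey.
by rewrite !maxEle; case: ifP => _; [right|case: ifP => //; left].
Qed.

Theorem corollary45 (R : realType) (s : scalar_kind) (A : kothe_matrix R)
    (p : kothe_exponent R) (w : int -> scalar_field R s)
    (w_neq0 : forall j : int, w j != 0)
    (w_bounded : shift_bounded A w)
    (w_inv_bounded : inverse_shift_bounded A w) :
  topologically_expansive (@kothe_seminorm R s A p)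
    (forward_shift p w_bounded) <->
  (exists k : nat,
     ereal_sup [set (modulus (\prod_(1 <= i < n.+1) w i%:Z) *
                     A (n%:Z + 1) k)%:E | n in [set n : nat | (1 <= n)%N]]
       = +oo%E \/
     ereal_sup [set ((modulus (\prod_(0 <= i < n) w (- i%:Z)))^-1 *
                     A (- n%:Z + 1) k)%:E | n in [set n : nat | (1 <= n)%N]]
       = +oo%E).
Proof.
have weight_prod0 : weight_prod (w := w) 0 = 1.
  by rewrite /= big_geq// modulus1.
split=> [[_ [S [_ _ SK expansive]]]|[k /weight_prod_sup]]; last first.
  move/ereal_sup_range_pinfty => supk; split.
    exact: forward_shift_continuous_linear.
  exists (unshift w_neq0 w_inv_bounded).
  have SK : cancel (unshift w_neq0 w_inv_bounded) (forward_shift p w_bounded).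
    exact: unshiftK.
  split=> [|||x x0].
  - exact: unshift_continuous_linear.
  - exact: forward_shiftK.
  - exact: SK.
  have [j xj] : exists j, x (j + 1) != 0.
    apply: contrapT => /forallNP xN; move/eqP: x0; apply.
    apply: val_inj; apply/funext => j /=.
    by have /negP := xN (j - 1); rewrite subrK negbK => /eqP.
  exists k; apply/ereal_sup_range_pinfty => M.
  (* This is the constant relating the orbit of [x], followed from coordinate j + 1, to that of e_1;
     the index k does not depend on [x]. *)
  have c_gt0 : 0 < modulus (x (j + 1)) / weight_prod (w := w) j.
    rewrite divr_gt0 ?weight_prod_gt0// lt_neqAle eq_sym modulus_eq0 xj.
    exact: modulus_ge0.
  have [n] := supk (M / (modulus (x (j + 1)) / weight_prod (w := w) j)).
  (* After n - j iterations the coordinate j + 1 sits at n + 1. *)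
  rewrite lte_fin ltr_pdivrMr// => Mn; exists (n - j).
  apply: lt_le_trans (kothe_norm_coord k (n + 1) _); rewrite lte_fin.
  apply: lt_le_trans Mn _.
  have := int_iter_forward_shift w_neq0 _ _ SK x (n - j) j.
  have uj := lt0r_neq0 (weight_prod_gt0 w_neq0 j).
  rewrite (addrC j) subrK => /(canRL (mulfK uj)) ->.
  by rewrite le_eqVlt; apply/orP; left; apply/eqP; ring.
pose e := unit_seq R s A p 1.
have [k supk] : exists k, ereal_sup (range (fun n : int =>
    kothe_seminorm k (int_iter (forward_shift p w_bounded) S n e))) = +oo%E.
  apply: expansive; apply/eqP => e0.
  have : e 1 = 0 by rewrite e0.
  by move=> /eqP; rewrite /= oner_eq0.
exists k; apply/weight_prod_sup; rewrite -supk.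
congr (ereal_sup (_ @` _)).
apply/funext => n; have orbit := int_iter_forward_shift w_neq0 _ _ SK e n.
rewrite /kothe_seminorm (@kothe_norm_supp1 _ _ _ _ k (n + 1)).
  have := orbit 0; rewrite !add0r weight_prod0 mulr1 /= => ->.
  by rewrite modulus1 mul1r.
(* Coordinate i of the n-th iterate comes from coordinate i - n of e_1, which is 0 since i differs
   from n + 1; the positive weight then cancels. *)
move=> i in1; have := orbit (i - n - 1).
have [-> ->] : i - n - 1 + n + 1 = i /\ i - n - 1 + 1 = i - n by lia.
have -> : e (i - n) = 0.
  by rewrite /= (_ : (i - n == 1) = false)//; apply/negbTE; lia.
rewrite modulus0 mul0r => /eqP.
rewrite mulf_eq0 (gt_eqF (weight_prod_gt0 w_neq0 _)) orbF modulus_eq0.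
by move/eqP.
Qed.
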